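(* Let $n$ be a positive integer and assume that the $n$-Degree Conjecture is true. If a $\mathbb{C}$-algebra endomorphism $F:\mathbb{C}[x_1,\ldots,x_n]\to\mathbb{C}[x_1,\ldots,x_n]$ has an invertible Jacobian and if at least one of the polynomials $F_j=F(x_j)$, $1\le j\le n$, has degree $1$, then $F$ is an automorphism.
   Context: For a $\mathbb{C}$-algebra endomorphism $F$ of $\mathbb{C}[x_1,\ldots,x_n]$ write $F_i=F(x_i)$. We say $F$ has an invertible Jacobian if $\operatorname{Jac}(F_1,\ldots,F_n)=\det(\partial F_i/\partial x_j)\in\mathbb{C}^*$. Degrees of polynomials are total degrees. The $n$-Degree Conjecture is the statement: for every $\mathbb{C}$-algebra endomorphism $F$ of $\mathbb{C}[x_1,\ldots,x_n]$ with an invertible Jacobian, if $d$ is the minimum of the degrees of $F_1,\ldots,F_n$, then the degree of the field extension $\mathbb{C}(F_1,\ldots,F_n)\subseteq\mathbb{C}(x_1,\ldots,x_n)$ is less than or equal to $d^{n-1}$. *)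

(* Defs.v *)
From HB Require Import structures.
From mathcomp Require Import all_boot all_order all_algebra.
From mathcomp Require Import fraction.
From mathcomp Require Import classical_sets reals.
From mathcomp Require Import complex mpoly.

Set Implicit Arguments.
Unset Strict Implicit.
Unset Printing Implicit Defensive.

Import GRing.Theory.
Local Open Scope ring_scope.
Local Open Scope complex_scope.

(* Total degree; [msize p] is one more than the degree, and 0 for p = 0. The
   zero polynomial is given degree 0, but it is never a component of a map
   with invertible Jacobian. *)
Definition tdeg (n : nat) (C : nzRingType) (p : {mpoly C[n]}) : nat :=
  (msize p).-1.

Definition jacobian (n : nat) (C : comNzRingType)
    (F : {lrmorphism {mpoly C[n]} -> {mpoly C[n]}}) : {mpoly C[n]} :=
  \det (\matrix_(i < n, j < n) (F 'X_i)^`M(j)).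

Definition invertible_jacobian (n : nat) (C : fieldType)
    (F : {lrmorphism {mpoly C[n]} -> {mpoly C[n]}}) : Prop :=
  exists2 c : C, c != 0 & jacobian F = c%:MP.

Definition generated_subfield (L : fieldType) (A : set L) : set L :=
  smallest (fun K : set L => divring_closed (mem K)) A.

(* [L : K] = m: there is a K-basis of L with m elements. *)
Definition extension_degree (L : fieldType) (K : set L) (m : nat) : Prop :=
  exists b : 'I_m -> L, forall x : L, exists! c : {ffun 'I_m -> L},
    (forall i, K (c i)) /\ x = \sum_(i < m) c i * b i.

(* C(F_1, ..., F_n) inside C(x_1, ..., x_n). *)
Definition image_field (n : nat) (C : fieldType)
    (F : {lrmorphism {mpoly C[n]} -> {mpoly C[n]}}) :
    set {fraction {mpoly C[n]}} :=
  generated_subfield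
    (range (fun c : C => tofrac c%:MP_[n])
     `|` range (fun i : 'I_n => tofrac (F 'X_i)))%classic.

Definition is_min_degree (n : nat) (C : fieldType)
    (F : {lrmorphism {mpoly C[n]} -> {mpoly C[n]}}) (d : nat) : Prop :=
  (exists i : 'I_n, tdeg (F 'X_i) = d) /\
  (forall i : 'I_n, (d <= tdeg (F 'X_i))%N).

(* The bound in particular asserts that the extension is finite. *)
Definition degree_conjecture (R : realType) (n : nat) : Prop :=
  forall F : {lrmorphism {mpoly R[i][n]} -> {mpoly R[i][n]}},
    invertible_jacobian F ->
    forall d : nat, is_min_degree F d ->
    exists2 m : nat, extension_degree (image_field F) m & (m <= d ^ n.-1)%N.

(* Main.v *)
Require Import Defs.
From HB Require Import structures.
From mathcomp Require Import all_boot all_order all_algebra.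
From mathcomp Require Import fraction classical_sets boolp.
From mathcomp Require Import reals complex mpoly.
From mathcomp Require Import ring zify.

(* A component of degree 1 makes the minimal degree 1, so the conjecture gives
   C(F) = C(x): the map is birational, and it remains to prove Keller's theorem
   that a birational map with invertible Jacobian is an automorphism.

   The derivations d/dF_i extend to C[x], since the Jacobian is a constant.
   Write x_j = P(F)/Q(F) and suppose that Q is not constant. Let pi be a prime
   factor of Q(F), and g a prime of least degree in the contraction p of (pi)
   along F. Some d_i g is nonzero, hence outside p by minimality, so pi does not
   divide (d/dF_i) pi. If r in p satisfies d_i r = 0, then r(F) is divisible by
   pi^2, so all derivatives of r stay in p and r = 0. Eliminating the i-th
   variable between g and an element of p thus shows p = (g). Both P and Q lie
   in p, so g cancels, and Q can be made constant by descent on its degree. *)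

Set Implicit Arguments.
Unset Strict Implicit.
Unset Printing Implicit Defensive.

Import GRing.Theory Num.Theory.
Local Open Scope ring_scope.
Local Open Scope complex_scope.

(** * Unique factorization *)

Definition divides (R : comNzRingType) (a b : R) : Prop := exists c, b = a * c.

Definition prime_element (R : comUnitRingType) (p : R) : Prop :=
  [/\ p != 0, p \isn't a GRing.unit &
      forall a b, divides p (a * b) -> divides p a \/ divides p b].

Inductive prime_product (R : comUnitRingType) : R -> Prop :=
| prime_product_unit u of u \is a GRing.unit : prime_product u
| prime_product_mul p a of prime_element p & prime_product a :
    prime_product (p * a).

(** In a domain, factorizations into prime elements are automatically unique, so asking for their
    existence is enough. *)
Definition factorial_ring (R : comUnitRingType) : Prop :=
  forall a : R, a != 0 -> prime_product a.

Section Divides.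
Variable R : comNzRingType.
Implicit Types a b c : R.

Lemma divides_mulr a b c : divides a b -> divides a (b * c).
Proof. by case=> d ->; exists (d * c); rewrite mulrA. Qed.

Lemma divides_mull a b c : divides a b -> divides a (c * b).
Proof. by rewrite mulrC; apply: divides_mulr. Qed.

Lemma dividesD a b c : divides a b -> divides a c -> divides a (b + c).
Proof. by case=> x -> [y ->]; exists (x + y); rewrite mulrDr. Qed.

Lemma dividesN a b : divides a b -> divides a (- b).
Proof. by case=> x ->; exists (- x); rewrite mulrN. Qed.

Lemma dividesB a b c : divides a b -> divides a c -> divides a (b - c).
Proof. by move=> ab /dividesN; apply: dividesD. Qed.

Lemma divides0 a : divides a 0.
Proof. by exists 0; rewrite mulr0. Qed.

End Divides.

Lemma divides_unit (R : comUnitRingType) (a u : R) :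
  u \is a GRing.unit -> divides a u -> a \is a GRing.unit.
Proof. by move=> uu [c E]; move: uu; rewrite E unitrM => /andP[]. Qed.

Lemma prime_productM (R : comUnitRingType) (a b : R) :
  prime_product a -> prime_product b -> prime_product (a * b).
Proof.
move=> ppa ppb; elim: ppa => [u uu|p c pp _ IH]; last first.
  by rewrite -mulrA; apply: prime_product_mul.
elim: ppb => [v vu|p c pp ppc IH].
  by apply: prime_product_unit; rewrite unitrM uu.
by rewrite mulrCA; apply: prime_product_mul.
Qed.

(** Peeling off primes one at a time, [S] must land on one of them, since the final unit cannot
    satisfy it. The predicate [S] abstracts two cases: lying in the contraction of a prime ideal,
    and being a non-unit. *)
Lemma prime_product_factor (R : comUnitRingType) (S : R -> Prop) (a : R) :
    (forall u, u \is a GRing.unit -> ~ S u) ->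
    (forall x y, S (x * y) -> S x \/ S y) ->
  prime_product a -> S a -> exists2 p, prime_element p & S p /\ divides p a.
Proof.
move=> Su Sm; elim=> [u /Su //|p b pp _ IH] /Sm[Sp|/IH[q qp [Sq qb]]].
  by exists p => //; split=> //; exists b.
by exists q => //; split=> //; apply: divides_mull.
Qed.

(** * Gauss's lemma and unique factorization in [{poly R}] *)

Section Gauss.
Variable R : idomainType.
Implicit Types (a b c : R) (f g d e : {poly R}).

Lemma size_factor_polyC c f g : c != 0 -> c%:P = f * g -> (size f <= 1)%N.
Proof.
move=> c0 E; have fg0 : f * g != 0 by rewrite -E polyC_eq0.
move: (fg0); rewrite mulf_eq0 negb_or => /andP[f0 g0].
have := size_mul f0 g0; rewrite -E size_polyC c0.
by have := g0; rewrite -size_poly_gt0; lia.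
Qed.

Lemma prime_element_polyC (p : R) : prime_element p -> prime_element p%:P.
Proof.
case=> p0 pu pm; split; first by rewrite polyC_eq0.
  by rewrite poly_unitE coefC eqxx (negPf pu) andbF.
have divC f : divides p%:P f -> divides p (lead_coef f).
  by case=> h ->; exists (lead_coef h); rewrite mul_polyC lead_coefZ.
have divT f g : divides p (lead_coef f) ->
    divides p%:P (f * g) ->
    divides p%:P ((f - (lead_coef f)%:P * 'X^((size f).-1)) * g).
  case=> c cE fg; rewrite mulrBl; apply: dividesB => //.
  by rewrite cE rmorphM -!mulrA; eexists; reflexivity.
have divB f : divides p (lead_coef f) ->
    divides p%:P (f - (lead_coef f)%:P * 'X^((size f).-1)) -> divides p%:P f.
  case=> c -> /dividesD h; rewrite -[f](subrK ((p * c)%:P * 'X^((size f).-1))).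
  by apply: h; rewrite rmorphM -mulrA; eexists; reflexivity.
have szT f : f != 0 ->
    (size (f - (lead_coef f)%:P * 'X^((size f).-1))%R < size f)%N.
  move=> f0; have sf : (0 < size f)%N by rewrite size_poly_gt0.
  rewrite -[X in (_ < X)%N](prednK sf) ltnS; apply/leq_sizeP => j.
  rewrite leq_eqVlt coefB coefCM coefXn => /orP[/eqP<-|lj].
    by rewrite eqxx mulr1 subrr.
  rewrite gtn_eqF // mulr0 subr0 nth_default //.
  by rewrite -(prednK sf).
suff main n : forall f g, (size f + size g <= n)%N -> divides p%:P (f * g) ->
    divides p%:P f \/ divides p%:P g by move=> f g; apply: main (leqnn _).
elim: n => [|n IH] f g szfg dfg.
  move: szfg; rewrite leqn0 addn_eq0 size_poly_eq0 => /andP[/eqP-> _].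
  by left; apply: divides0.
have [->|f0] := eqVneq f 0; first by left; apply: divides0.
have [->|g0] := eqVneq g 0; first by right; apply: divides0.
have := divC _ dfg; rewrite lead_coefM => /pm[lf|lg].
  have [||h|] := IH (f - (lead_coef f)%:P * 'X^((size f).-1)) g; last by right.
  - by rewrite -ltnS (leq_trans _ szfg) // ltn_add2r szT.
  - exact: divT.
  - by left; apply: divB.
have [|| |h] := IH f (g - (lead_coef g)%:P * 'X^((size g).-1)); last 1 first.
- by right; apply: divB.
- by rewrite -ltnS (leq_trans _ szfg) // ltn_add2l szT.
- by rewrite mulrC; apply: divT => //; rewrite mulrC.
- by left.
Qed.

Lemma prime_product_polyC c : prime_product c -> prime_product c%:P.
Proof.
elim=> [u uu|p a pp _ IH].
  by apply: prime_product_unit; rewrite poly_unitE size_polyC coefC eqxx uu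
     (memPn _ _ uu) ?unitr0.
by rewrite rmorphM; apply: prime_product_mul => //; apply: prime_element_polyC.
Qed.

(** Each prime factor of [c] stays prime in [{poly R}], so it divides [d] or [e] and can be
    cancelled there. The pair [ab] records how [c] is shared out, and [de] what remains of the two
    factors. *)
Lemma gauss_factor c f d e : prime_product c -> c%:P * f = d * e ->
  exists ab de, [/\ d = ab.1%:P * de.1, e = ab.2%:P * de.2 & f = de.1 * de.2].
Proof.
move=> ppc; elim: ppc f d e => [u uu|p a pp _ IH] f d e.
  move=> E; exists (1, u), (d, u^-1%:P * e) => /=; split.
  - by rewrite mul1r.
  - by rewrite mulrA -rmorphM divrr // mul1r.
  - by rewrite mulrCA -E mulrA -rmorphM mulVr // mul1r.
rewrite rmorphM -mulrA => E.
have [pP0 _ pPm] := prime_element_polyC pp.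
have /pPm[[h hE]|[h hE]] : divides p%:P (d * e) by rewrite -E; eexists.
  have /IH[[x y] [[d' e'] /= [hx -> ->]]] : a%:P * f = h * e.
    by apply: (mulfI pP0); rewrite E hE mulrA.
  by exists (p * x, y), (d', e'); split => //=; rewrite hE hx rmorphM mulrA.
have /IH[[x y] [[d' e'] /= [-> hy ->]]] : a%:P * f = d * h.
  by apply: (mulfI pP0); rewrite E hE mulrCA.
by exists (x, p * y), (d', e'); split => //=; rewrite hE hy rmorphM mulrA.
Qed.

Definition primitive_poly f : Prop :=
  forall p, prime_element p -> ~ divides p%:P f.

(* Over the field of fractions of [R], the prime [g] and [b] are coprime; clear
   denominators in a Bezout relation. *)
Lemma prime_poly_elimination g (b : {poly R}) :
  prime_element g -> (1 < size g)%N ->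
  ~ divides g b -> exists u v c, c != 0 /\ u * g + v * b = c%:P.
Proof.
move=> [g0 _ gm] szg ngb.
have dvdC c : c != 0 -> ~ divides g c%:P.
  by move=> c0 [h /(size_factor_polyC c0)]; rewrite leqNgt szg.
have [szd|szd] := leqP (size (gcdp g b)) 1.
  have : coprimep g b.
    by rewrite /coprimep eqn_leq szd size_poly_gt0 gcdp_eq0 (negPf g0).
  case/Bezout_coprimepP => -[u v] /= /eqpP[[k1 k2] /= /andP[k10 k20] E].
  exists (k1 *: u), (k1 *: v), k2; split=> //.
  by rewrite -!scalerAl -scalerDr E alg_polyC.
(* A nonconstant gcd [d] is a multiple of [g]: otherwise [g] divides the cofactor [q], and [d]
   divides the nonzero constant [c]. Hence [g] divides [c'%:P * b], and so [b]. *)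
case: ngb; have /Pdiv.WeakIdomain.dvdpP[[c q] /= c0] := dvdp_gcdl g b.
set d := gcdp g b in szd *; rewrite -mul_polyC => cE.
have /Pdiv.WeakIdomain.dvdpP[[c' q'] /= c'0] := dvdp_gcdr g b.
rewrite -/d -mul_polyC => c'E.
have /gm[[h qE]|[h dE]] : divides g (q * d).
- by rewrite -cE; apply: divides_mull; exists 1; rewrite mulr1.
- have /(size_factor_polyC c0) : c%:P = d * h.
    by apply: (mulfI g0); rewrite mulrC cE qE mulrA mulrAC.
  by rewrite leqNgt szd.
have /gm[/dvdC|//] : divides g (c'%:P * b); last by case.
by rewrite c'E dE; apply: divides_mull; exists h.
Qed.

Hypothesis factR : factorial_ring R.

Lemma primitive_const_unit f a : f != 0 -> primitive_poly f ->
  divides a%:P f -> a \is a GRing.unit.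
Proof.
move=> f0 prf af; have /factR pa : a != 0.
  by apply: contraNneq f0 => a0; case: af => x ->; rewrite a0 mul0r.
case: pa af => // p b pp _ [x E]; case: (prf p pp).
by exists (b%:P * x); rewrite E rmorphM mulrA.
Qed.

(** The part of [c] that falls to [f] under [gauss_factor] is a unit because [f] is primitive. Thus
    divisibility by [f] over the field of fractions descends to [R]. *)
Lemma primitive_divides_cancel f g h c : f != 0 -> primitive_poly f ->
  c != 0 -> c%:P * g = f * h -> divides f g.
Proof.
move=> f0 prf /factR ppc /(gauss_factor ppc)[[a b] [[d e] /= [fE hE gE]]].
have au : a \is a GRing.unit.
  by apply: (@primitive_const_unit f) => //; exists d.
by exists (a^-1%:P * e); rewrite gE fE mulrACA -rmorphM divrr // mul1r.
Qed.

(** Irreducibility over the field of fractions of [R]: the multiplier [c] absorbs the denominators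
    of a factorization. *)
Definition primitively_irreducible f : Prop :=
  forall c d e, c != 0 -> c%:P * f = d * e ->
    (size d <= 1)%N || (size e <= 1)%N.

(** If [f] and [g] have a constant gcd, a Bezout relation multiplied by [h] puts a constant multiple
    of [h] in the ideal of [f]. Otherwise irreducibility makes the gcd equal to [f] up to constants,
    so [f] divides a constant multiple of [g]. Primitivity removes the constants in both cases. *)
Lemma prime_element_poly f : (1 < size f)%N -> primitive_poly f ->
  primitively_irreducible f -> prime_element f.
Proof.
move=> szf prf irf.
have f0 : f != 0 by rewrite -size_poly_gt0 (ltn_trans _ szf).
split=> // [|g h [w ghE]].
  by rewrite poly_unitE gtn_eqF.
have [szd|szd] := leqP (size (gcdp f g)) 1.
  have cop : coprimep f g.
    by rewrite /coprimep eqn_leq szd size_poly_gt0 gcdp_eq0 (negPf f0).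
  right; case/Bezout_coprimepP: cop => -[u v] /= /eqpP[[k1 k2] /=].
  case/andP=> k10 k20 E; apply: (@primitive_divides_cancel f h
      (k1 *: (u * h + v * w)) k2) => //.
  have : k2%:P * h = (k1 *: (u * f + v * g)) * h.
    by rewrite E -mul_polyC mulr1.
  move=> ->; rewrite -!scalerAl -scalerAr; congr (_ *: _).
  rewrite mulrDl mulrDr -!mulrA ghE; congr (_ + _); first by rewrite mulrCA.
  by rewrite mulrCA.
have /Pdiv.WeakIdomain.dvdpP[[c q] /= c0] := dvdp_gcdl f g.
set d := gcdp f g in szd * => cE.
have /Pdiv.WeakIdomain.dvdpP[[c' q'] /= c'0 c'E] := dvdp_gcdr f g.
left; have /irf-/(_ c0) : c%:P * f = q * d by rewrite mul_polyC.
rewrite [X in _ || X]leqNgt szd orbF => /size1_polyC qE.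
have q0 : q`_0 != 0.
  apply: contraNneq f0 => q00; move: cE; rewrite qE q00 mul0r => /eqP.
  by rewrite scale_poly_eq0 (negPf c0).
apply: (@primitive_divides_cancel f g (c%:P * q') (q`_0 * c')) => //.
  exact: mulf_neq0.
rewrite polyCM -qE -mulrA mul_polyC c'E mulrCA -cE -mul_polyC [RHS]mulrA mulrC.
by rewrite [f * _]mulrC.
Qed.

Lemma primitive_decomposition f : f != 0 ->
  exists2 a, a != 0 & exists2 g, f = a%:P * g & primitive_poly g.
Proof.
move=> f0; have : forall a, divides a%:P f -> divides a (lead_coef f).
  by move=> a [h ->]; exists (lead_coef h); rewrite mul_polyC lead_coefZ.
have /factR pl : lead_coef f != 0 by rewrite lead_coef_eq0.
(* From here on, [l] is any element divisible by all constant divisors of [f]. In the induction on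
   its primes, a prime [p] is removed from both [l] and [f] if it divides [f], and from [l] alone
   otherwise. *)
clear f0; move: (lead_coef f) pl => l pl.
elim: pl f => [u uu|p {}l [p0 pu pm] _ IH] f hf.
  exists 1; first exact: oner_neq0.
  exists f; first by rewrite mul1r.
  by move=> q [_ qu _] /hf /(divides_unit uu); rewrite (negPf qu).
have [[g fE]|npf] := EM (divides p%:P f).
  have /IH[a a0 [h gE prh]] : forall a, divides a%:P g -> divides a l.
    move=> a [h gE]; have [|x E] := hf (p * a).
      by exists h; rewrite fE gE rmorphM mulrA.
    by exists x; apply: (mulfI p0); rewrite E mulrA.
  exists (p * a); first exact: mulf_neq0.
  by exists h => //; rewrite fE gE rmorphM mulrA.
apply: IH => a af; case: (hf a af) => t E.
have /pm[[x aE]|[x tE]] : divides p (a * t) by exists l.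
  by case: npf; case: af => y ->; exists (x%:P * y); rewrite aE rmorphM mulrA.
by exists x; apply: (mulfI p0); rewrite E tE mulrCA.
Qed.

(** Strong induction on the size. A nonconstant [f] irreducible over the field of fractions is a
    constant times a prime; any other nonconstant [f] splits into two factors of smaller size by
    [gauss_factor]. *)
Theorem factorial_poly : factorial_ring {poly R}.
Proof.
move=> f; have [n] := ubnP (size f); elim: n f => // n IH f szf f0.
have [sz1|sz1] := leqP (size f) 1.
  have fE := size1_polyC sz1; rewrite fE; apply/prime_product_polyC/factR.
  by rewrite -polyC_eq0 -fE.
have [irf|] := EM (primitively_irreducible f).
  have [a a0 [g fE prg]] := primitive_decomposition f0.
  rewrite fE; apply: prime_productM.
    exact/prime_product_polyC/factR.
  rewrite -[g]mulr1; apply: prime_product_mul; last first.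
    by apply: prime_product_unit; apply: unitr1.
  apply: prime_element_poly => //.
    by rewrite -(size_scale g a0) -mul_polyC -fE.
  move=> c d e c0 cE; rewrite -(size_scale d a0) -mul_polyC.
  by apply: (irf c) => //; rewrite fE mulrCA cE mulrA.
move=> /existsNP[c /existsNP[d /existsNP[e /not_implyP[c0 /not_implyP[cE]]]]].
move=> /negP; rewrite negb_or -!ltnNge => /andP[szd sze].
have [|[a b] [[d' e'] /= [dE eE fE]]] := gauss_factor _ cE; first exact: factR.
have szC (x y : {poly R}) z : (1 < size x)%N -> x = z%:P * y -> (1 < size y)%N.
  move=> sx xE; apply: leq_trans sx _; rewrite xE mul_polyC.
  exact: size_scale_leq.
have {}szd := szC _ _ _ szd dE.
have {}sze := szC _ _ _ sze eE.
move: f0 szf; rewrite fE mulf_eq0 negb_or => /andP[d0 e0].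
rewrite size_mul // => szf; apply: prime_productM; apply: IH => //.
- by move: szf szd sze; lia.
- by move: szf szd sze; lia.
Qed.

End Gauss.

(** * Transport of primes and factorizations along ring isomorphisms *)

Section Isomorphism.
Variables (R S : comUnitRingType).
Variables (f : {rmorphism R -> S}) (g : {rmorphism S -> R}).
Hypotheses (fK : cancel f g) (gK : cancel g f).

Lemma unit_iso x : (f x \is a GRing.unit) = (x \is a GRing.unit).
Proof.
by apply/idP/idP => [/(rmorph_unit g)|/(rmorph_unit f)//]; rewrite fK.
Qed.

Lemma divides_iso x y : divides (f x) y <-> divides x (g y).
Proof.
split=> -[z E]; first by exists (g z); rewrite E rmorphM fK.
by exists (f z); rewrite -rmorphM -E gK.
Qed.

Lemma prime_element_iso p : prime_element p -> prime_element (f p).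
Proof.
case=> p0 pu pm; split; first by rewrite -(rmorph0 f) (can_eq fK).
  by rewrite unit_iso.
by move=> x y /divides_iso; rewrite rmorphM => /pm[/divides_iso|/divides_iso];
  [left|right].
Qed.

Lemma factorial_ring_iso : factorial_ring R -> factorial_ring S.
Proof.
move=> factR a a0.
have /factR : g a != 0 by rewrite -(rmorph0 g) (can_eq gK).
rewrite -[in X in _ -> X](gK a); elim=> [u uu|p b pp _ IH].
  by apply: prime_product_unit; rewrite unit_iso.
by rewrite rmorphM; apply: prime_product_mul => //; apply: prime_element_iso.
Qed.

End Isomorphism.

Lemma prime_iso_elimination (R : idomainType) (S : comUnitRingType)
    (f : {rmorphism S -> {poly R}}) (g : {rmorphism {poly R} -> S}) (p b : S) :
    cancel f g -> cancel g f ->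
    prime_element p -> (1 < size (f p))%N -> ~ divides p b ->
  exists u v c, c != 0 /\ u * p + v * b = g c%:P.
Proof.
move=> fK gK /(prime_element_iso fK gK) pp szp npb.
have [|u [v [c [c0 E]]]] := prime_poly_elimination (b := f b) pp szp.
  by move/(divides_iso fK gK); rewrite fK.
by exists (g u), (g v), c; rewrite -E rmorphD !rmorphM !fK.
Qed.

Lemma mpoly_alg_ind (n : nat) (C : comNzRingType) (P : {mpoly C[n]} -> Prop) :
    (forall c, P c%:MP) -> (forall i, P 'X_i) ->
    (forall p q, P p -> P q -> P (p + q)) ->
    (forall p q, P p -> P q -> P (p * q)) ->
  forall p, P p.
Proof.
move=> PC PX PD PM; elim/mpolyind => [|c m p _ _ Pp]; first by rewrite -mpolyC0.
apply: (PD) => //; rewrite -mul_mpolyC; apply: (PM) => //.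
rewrite mpolyXE_id; apply: (big_ind P) => // [|i _]; first by rewrite -mpolyC1.
by elim: (m i) => [|k IH]; rewrite ?expr0 -?mpolyC1 // exprS; apply: PM.
Qed.

Lemma mpoly_rmorph_ext (n : nat) (C S : comNzRingType)
    (f g : {rmorphism {mpoly C[n]} -> S}) :
  (forall c, f c%:MP = g c%:MP) -> (forall i, f 'X_i = g 'X_i) -> f =1 g.
Proof.
move=> fgC fgX; elim/mpoly_alg_ind => // p q fp fq.
  by rewrite !rmorphD fp fq.
by rewrite !rmorphM fp fq.
Qed.

(** * Multivariate polynomials as univariate polynomials in a chosen variable *)

Section SingleOut.
Variables (n : nat) (C : fieldType) (i : 'I_n.+1).

Definition to_univariate : {mpoly C[n.+1]} -> {poly {mpoly C[n]}} :=
  mmap (polyC \o @mpolyC n C)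
    (fun k => if unlift i k is Some j then ('X_j)%:P else 'X).

Definition mlift : {mpoly C[n]} -> {mpoly C[n.+1]} :=
  mmap (@mpolyC n.+1 C) (fun j => 'X_(lift i j)).

Definition of_univariate : {poly {mpoly C[n]}} -> {mpoly C[n.+1]} :=
  horner_eval 'X_i \o map_poly mlift.

HB.instance Definition _ := GRing.RMorphism.on to_univariate.
HB.instance Definition _ := GRing.RMorphism.on mlift.
HB.instance Definition _ := GRing.RMorphism.on of_univariate.

Lemma mliftC c : mlift c%:MP = c%:MP.
Proof. exact: mmapC. Qed.

Lemma mliftX j : mlift 'X_j = 'X_(lift i j).
Proof. by rewrite /mlift mmapX mmap1U. Qed.

Lemma to_univariateC c : to_univariate c%:MP = (c%:MP)%:P.
Proof. exact: mmapC. Qed.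

Lemma to_univariateX k :
  to_univariate 'X_k = if unlift i k is Some j then ('X_j)%:P else 'X.
Proof. by rewrite /to_univariate mmapX mmap1U. Qed.

Lemma of_univariateC c : of_univariate c%:P = mlift c.
Proof. by rewrite /of_univariate /= map_polyC /horner_eval hornerC. Qed.

Lemma of_univariateX : of_univariate 'X = 'X_i.
Proof. by rewrite /of_univariate /= map_polyX /horner_eval hornerX. Qed.

Lemma to_univariateK : cancel to_univariate of_univariate.
Proof.
apply: (@mpoly_rmorph_ext _ _ _ (of_univariate \o to_univariate) idfun).
  by move=> c /=; rewrite to_univariateC of_univariateC mliftC.
move=> k /=; rewrite to_univariateX; case: unliftP => [j|] ->.
  by rewrite of_univariateC mliftX.
exact: of_univariateX.
Qed.

Lemma to_univariate_mlift p : to_univariate (mlift p) = p%:P.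
Proof.
move: p; apply: (@mpoly_rmorph_ext _ _ _ (to_univariate \o mlift) polyC).
  by move=> c /=; rewrite mliftC to_univariateC.
by move=> j /=; rewrite mliftX to_univariateX liftK.
Qed.

Lemma of_univariateK : cancel of_univariate to_univariate.
Proof.
elim/poly_ind => [|p c IH]; first by rewrite !rmorph0.
rewrite !(rmorphD, rmorphM) /= IH of_univariateX of_univariateC.
by rewrite to_univariate_mlift to_univariateX unlift_none.
Qed.

Lemma mderiv_mlift p : (mlift p)^`M(i) = 0.
Proof.
elim/mpoly_alg_ind: p => [c|j|p q IHp IHq|p q IHp IHq].
- by rewrite mliftC mderivC.
- by rewrite mliftX mderivX mnm1E eq_sym (negPf (neq_lift _ _)) scale0r.
- by rewrite rmorphD mderivD IHp IHq addr0.
- by rewrite rmorphM mderivM IHp IHq mul0r mulr0 addr0.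
Qed.

End SingleOut.

Theorem factorial_mpoly (n : nat) (C : fieldType) : factorial_ring {mpoly C[n]}.
Proof.
elim: n => [|n IH].
  move=> p p0; apply: prime_product_unit.
  rewrite -[p]mpolyKC rmorph_unit // unitfE; apply: contraNneq p0 => E.
  by rewrite -[p]mpolyKC E mpolyC0.
apply: (factorial_ring_iso (@of_univariateK n C ord0)).
  exact: to_univariateK.
exact: factorial_poly.
Qed.

(** The nonzero derivative forces [g] to have positive degree in the [i]-th variable, so this
    variable can be eliminated between [g] and [b]. What results is a nonzero polynomial in the
    other variables. *)
Lemma prime_elimination (n : nat) (C : fieldType) (i : 'I_n)
    (g b : {mpoly C[n]}) :
    prime_element g -> g^`M(i) != 0 -> ~ divides g b ->
  exists u v, u * g + v * b != 0 /\ (u * g + v * b)^`M(i) = 0.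
Proof.
case: n i g b => [[]//|n] i g b gp dg ngb.
have toK := @to_univariateK n C i; have ofK := @of_univariateK n C i.
have [|u [v [c [c0 E]]]] := prime_iso_elimination toK ofK gp _ ngb.
  rewrite ltnNge; apply/negP => /size1_polyC gE.
  by case/negP: dg; rewrite -[g]toK gE of_univariateC mderiv_mlift.
have {}E : u * g + v * b = mlift i c by rewrite E; apply: of_univariateC.
exists u, v; rewrite E mderiv_mlift; split=> //.
apply: contraNneq c0 => lc0; rewrite -polyC_eq0 -(to_univariate_mlift i) lc0.
by rewrite rmorph0.
Qed.

(** * Keller's theorem for birational maps *)

Section Derivatives.
Variables (n : nat) (C : numFieldType).
Implicit Types p q : {mpoly C[n]}.

Lemma msize_mderiv p i : p != 0 -> (msize p^`M(i) < msize p)%N.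
Proof.
move=> p0; rewrite -[X in (_ < X)%N]prednK ?lt0n ?msize_poly_eq0 // ltnS.
rewrite msizeE; apply/bigmax_leqP_seq => m.
rewrite mcoeff_msupp mcoeff_deriv mulrn_eq0 /= => mp _.
have : (m + U_(i))%MM \in msupp p by rewrite mcoeff_msupp.
by move/msize_mdeg_lt; rewrite mdegD mdeg1; lia.
Qed.

Lemma msize_ltM p q :
  (1 < msize p)%N -> q != 0 -> (msize q < msize (p * q)%R)%N.
Proof.
move=> p1 q0; have p0 : p != 0 by rewrite -msize_poly_eq0 -lt0n ltnW.
have := q0; rewrite -msize_poly_eq0 msizeM //.
by move: (msize p) (msize q) p1 => a b; lia.
Qed.

(** The coefficient of a monomial [m] with [m i] nonzero reappears in the [i]-th derivative
    multiplied by [m i], which is invertible in characteristic zero. *)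
Lemma mderiv_eq0_const p : (forall i, p^`M(i) = 0) -> p = (p@_0)%:MP.
Proof.
move=> dp; apply/mpolyP => m; rewrite mcoeffC.
have [->|m0] := eqVneq m 0%MM; first by rewrite mulr1.
rewrite mulr0; have [i mi] : exists i, m i != 0%N.
  apply/existsP; apply: contraNT m0; rewrite negb_exists => /forallP m0.
  by apply/eqP/mnmP => i; rewrite mnm0E; apply/eqP; rewrite -[_ == _]negbK.
have mE : m = ((m - U_(i)) + U_(i))%MM.
  apply/mnmP => j; rewrite mnmDE mnmBE mnm1E; case: eqP => [<-|_]; last by lia.
  by move: mi; lia.
have /(congr1 (fun q => q@_(m - U_(i)))) := dp i.
by rewrite mcoeff_deriv -mE mcoeff0 => /eqP; rewrite mulrn_eq0 /= => /eqP.
Qed.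

(** A nonzero element of [S] of least size would have only zero derivatives, hence be a nonzero
    constant in [S]. *)
Lemma mderiv_stable_eq0 (S : {mpoly C[n]} -> Prop) :
    (forall p i, S p -> S p^`M(i)) -> (forall c, S c%:MP -> c = 0) ->
  forall p, S p -> p = 0.
Proof.
move=> Sd SC p; have [k] := ubnP (msize p); elim: k p => // k IH p pk Sp.
have [//|p0] := eqVneq p 0.
have pE : p = (p@_0)%:MP.
  apply: mderiv_eq0_const => i; apply: IH; last exact: Sd.
  by rewrite -ltnS (leq_trans _ pk) // ltnS msize_mderiv.
by move: Sp; rewrite pE => /SC ->; rewrite mpolyC0.
Qed.

End Derivatives.

(** * Derivations along [F], contraction of primes and removal of denominators *)

Section Keller.
Variables (n : nat) (C : numFieldType).
Variable F : {lrmorphism {mpoly C[n]} -> {mpoly C[n]}}.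
Implicit Types p q u : {mpoly C[n]}.

Lemma lrmorph_mpolyC c : F c%:MP = c%:MP.
Proof. by rewrite -[c%:MP]mulr1 mul_mpolyC linearZ rmorph1. Qed.

Lemma chain_rule p j :
  (F p)^`M(j) = \sum_k F p^`M(k) * (F 'X_k)^`M(j).
Proof.
elim/mpoly_alg_ind: p => [c|i|p q IHp IHq|p q IHp IHq].
- rewrite lrmorph_mpolyC mderivC big1 // => k _.
  by rewrite mderivC rmorph0 mul0r.
- rewrite (bigD1 i) //= big1 => [|k ki]; rewrite mderivX mnm1E.
    have -> : (U_(i) - U_(i) = 0)%MM by rewrite -{1}[U_(i)%MM]add0m addmK.
    by rewrite eqxx scale1r mpolyX0 rmorph1 mul1r addr0.
  by rewrite eq_sym (negPf ki) scale0r rmorph0 mul0r.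
- rewrite rmorphD mderivD IHp IHq -big_split /=; apply: eq_bigr => k _.
  by rewrite mderivD rmorphD mulrDl.
- rewrite rmorphM mderivM IHp IHq big_distrl big_distrr -big_split /=.
  apply: eq_bigr => k _; rewrite mderivM rmorphD !rmorphM; ring.
Qed.

Hypothesis jacF : invertible_jacobian F.

(* The derivation extending d/dF_i; inverting the Jacobian matrix makes it
   polynomial. *)
Lemma pushed_derivation : exists D : 'I_n -> {mpoly C[n]} -> {mpoly C[n]},
  [/\ forall i, D i 0 = 0,
      forall i p q, D i (p * q) = D i p * q + p * D i q &
      forall i p, D i (F p) = F p^`M(i)].
Proof.
case: jacF => c c0 jE; pose J : 'M_n := \matrix_(i < n, j < n) (F 'X_i)^`M(j).
exists (fun i p => c^-1 *: \sum_j p^`M(j) * (\adj J) j i); split.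
- by move=> i; rewrite big1 ?scaler0 // => j _; rewrite mderiv0 mul0r.
- move=> i p q; rewrite -scalerAl -scalerAr -scalerDr; congr (_ *: _).
  rewrite big_distrl big_distrr -big_split /=; apply: eq_bigr => j _.
  by rewrite mderivM; ring.
move=> i p.
have -> : \sum_j (F p)^`M(j) * (\adj J) j i =
    \sum_k F p^`M(k) * (J *m \adj J) k i.
  under eq_bigr do rewrite chain_rule big_distrl /=.
  rewrite exchange_big; apply: eq_bigr => k _; rewrite mxE big_distrr /=.
  by apply: eq_bigr => j _; rewrite [J k j]mxE mulrA.
rewrite mul_mx_adj (bigD1 i) //= big1 => [|k ki].
  rewrite mxE eqxx mulr1n addr0 mulrC -/(jacobian F) jE mul_mpolyC.
  by rewrite scalerA mulVf // scale1r.
by rewrite mxE (negPf ki) mulr0n mulr0.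
Qed.

(** The kernel of [F] is stable under partial derivatives, since [D i] extends them along [F], and
    it contains no nonzero constant. *)
Lemma jacobian_injective : injective F.
Proof.
have [D [D0 _ DF]] := pushed_derivation.
apply: raddf_inj.
apply: (@mderiv_stable_eq0 _ _ (fun p => F p = 0)) => [p i Fp|c].
  by rewrite -DF Fp D0.
by rewrite lrmorph_mpolyC => /eqP; rewrite mpolyC_eq0 => /eqP.
Qed.

(** This supplies a common factor of a numerator and a denominator lying in the contraction of the
    ideal of [q]; that [g] is nonconstant lets the cancellation lower the size. *)
Lemma prime_contraction q a : prime_element q ->
    a != 0 -> divides q (F a) ->
  exists2 g, prime_element g &
    (1 < msize g)%N /\ forall b, divides q (F b) -> divides g b.
Proof.
move=> [q0 qu qm] a0 qa; have [D [D0 DM DF]] := pushed_derivation.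
pose S p := divides q (F p).
have SC c : S c%:MP -> c = 0.
  rewrite /S lrmorph_mpolyC => qc; apply/eqP; apply: contraNT qu => c0.
  by apply: divides_unit qc; apply: rmorph_unit; rewrite unitfE.
have SM x y : S (x * y) -> S x \/ S y by rewrite /S rmorphM; apply: qm.
have Su u : u \is a GRing.unit -> ~ S u.
  by move=> uu Su; move: qu; rewrite (divides_unit (rmorph_unit F uu) Su).
(* Take a nonzero element of [S] of least size; one of its prime factors is again in [S], and it is
   no larger. *)
have [g gp [Sg gmin]] : exists2 g, prime_element g &
    S g /\ forall b, S b -> b != 0 -> (msize g <= msize b)%N.
  have exP : exists k, `[< exists2 b, b != 0 & S b /\ msize b = k >].
    by exists (msize a); apply/asboolP; exists a.
  case: (ex_minnP exP) => k /asboolP[b b0 [Sb bk]] kmin.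
  have [g gp [Sg [h bE]]] := prime_product_factor Su SM (factorial_mpoly b0) Sb.
  exists g => //; split=> // x Sx x0.
  apply: (@leq_trans k); last by apply: kmin; apply/asboolP; exists x.
  move: b0; rewrite -bk bE mulf_eq0 negb_or => /andP[g0 h0].
  rewrite msizeM //; have : (0 < msize h)%N by rewrite lt0n msize_poly_eq0.
  by lia.
have g0 : g != 0 by case: gp.
have [i dg] : exists i, g^`M(i) != 0.
  apply/not_existsP => dg; case/eqP: g0.
  have gE : g = (g@_0)%:MP.
    by apply: mderiv_eq0_const => i; apply/eqP/negP => /negP; apply: dg.
  by move: Sg; rewrite gE => /SC ->; rewrite mpolyC0.
have nSdg : ~ S g^`M(i).
  by move=> /gmin-/(_ dg); rewrite leqNgt msize_mderiv.
(* Differentiate [F g = q * s]: if [q] divided [D i q], it would divide [D i (F g)], putting the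
   [i]-th derivative of [g] in [S]. *)
have nDq : ~ divides q (D i q).
  case: Sg => s gE qDq; apply: nSdg; rewrite /S -DF gE DM.
  by apply: dividesD; [apply: divides_mulr|exists (D i s)].
(* If [d_i r = 0] then [q ^ 2] divides [F r], so all derivatives of [r] stay
   in the contraction. *)
have S0 r : S r -> r^`M(i) = 0 -> r = 0.
  move=> Sr dr; apply: (@mderiv_stable_eq0 _ _
    (fun r => S r /\ r^`M(i) = 0)) => [p j|c [/SC //]|//].
  case=> [[w pE] dp]; split; last by rewrite mderiv_comm dp mderiv0.
  have : divides q (D i q * w).
    have : D i (F p) = 0 by rewrite DF dp rmorph0.
    rewrite pE DM => /eqP; rewrite addr_eq0 => /eqP ->.
    by apply: dividesN; exists (D i w).
  move=> /qm[//|[v wE]]; rewrite /S -DF pE wE !DM.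
  by exists (D j q * v + (D j q * v + q * D j v)); ring.
exists g => //; split.
  by rewrite (leq_ltn_trans _ (msize_mderiv i g0)) // lt0n msize_poly_eq0.
move=> b Sb; apply: contrapT => ngb.
(* The eliminant [x * g + y * b] lies in [S] and is killed by the [i]-th derivative, so [S0] makes
   it zero, a contradiction. *)
have [x [y [nz]]] := prime_elimination gp dg ngb.
move/S0 => r0; move: nz; rewrite r0 ?eqxx // /S rmorphD !rmorphM.
by apply: dividesD; apply: divides_mull.
Qed.

(** Descent on the size of [q]. If [F q] is a unit, it is a nonzero constant and a scalar multiple
    of [p] works. Otherwise [p] and [q] both lie in the contraction of a prime factor of [F q],
    hence share a nonconstant factor, which cancels by injectivity of [F]. *)
Lemma denominator_free u p q : q != 0 -> F p = u * F q ->
  exists r, F r = u.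
Proof.
have [k] := ubnP (msize q); elim: k p q => // k IH p q qk q0 E.
have Fq0 : F q != 0 by rewrite -(rmorph0 F) (inj_eq jacobian_injective).
have [Fqu|Fqu] := boolP (F q \is a GRing.unit).
  move: Fqu; rewrite qualifE /= => /andP[/eqP FqE]; rewrite unitfE => c0.
  move: FqE E; set c := (F q)@_0 => FqE E.
  exists (c^-1 *: p); rewrite linearZ /= E FqE mulrC mul_mpolyC.
  by rewrite scalerA mulVf // scale1r.
have nu (x y : {mpoly C[n]}) : x * y \isn't a GRing.unit ->
    x \isn't a GRing.unit \/ y \isn't a GRing.unit.
  by rewrite unitrM negb_and => /orP.
have uu (x : {mpoly C[n]}) : x \is a GRing.unit -> ~ x \isn't a GRing.unit.
  by move=> ->.
have [pi pip [_ piFq]] :=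
  prime_product_factor uu nu (factorial_mpoly Fq0) Fqu.
have [g [g0 _ _] [szg gdiv]] := prime_contraction pip q0 piFq.
have [p' pE] : divides g p by apply: gdiv; rewrite E; apply: divides_mull.
have [q' qE] : divides g q by apply: gdiv.
move: q0 qk; rewrite qE mulf_eq0 negb_or => /andP[_ q'0] qk.
apply: (IH p' q') => //.
  by rewrite -ltnS (leq_trans _ qk) // ltnS msize_ltM.
have Fg0 : F g != 0 by rewrite -(rmorph0 F) (inj_eq jacobian_injective).
by move: E; rewrite pE qE !rmorphM mulrCA => /(mulfI Fg0).
Qed.

End Keller.

(** * From an extension of degree at most one to bijectivity *)

Definition image_fraction (n : nat) (C : fieldType)
    (F : {lrmorphism {mpoly C[n]} -> {mpoly C[n]}}) :
    set {fraction {mpoly C[n]}} :=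
  fun x => exists p q, F q != 0 /\ x = tofrac (F p) / tofrac (F q).

Section Birational.
Variables (n : nat) (C : numFieldType).
Variable F : {lrmorphism {mpoly C[n]} -> {mpoly C[n]}}.

Lemma image_fraction_tofrac p : image_fraction F (tofrac (F p)).
Proof. by exists p, 1; rewrite rmorph1 oner_neq0 tofrac1 divr1. Qed.

Lemma image_fraction_div x y :
  image_fraction F x -> image_fraction F y -> image_fraction F (x / y).
Proof.
move=> [p [q [q0 ->]]] [p' [q' [q'0 ->]]].
(* When [y] is zero, [x / y] is zero by convention and is still a fraction of the image. *)
have [E|p'0] := eqVneq (F p') 0.
  rewrite E tofrac0 mul0r invr0 mulr0 -tofrac0 -(rmorph0 F).
  exact: image_fraction_tofrac.
exists (p * q'), (q * p'); rewrite !rmorphM /= mulf_neq0 //; split=> //.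
by rewrite invf_div mulf_div.
Qed.

Lemma image_fractionB x y :
  image_fraction F x -> image_fraction F y -> image_fraction F (x - y).
Proof.
move=> [p [q [q0 ->]]] [p' [q' [q'0 ->]]].
exists (p * q' - p' * q), (q * q'); rewrite rmorphM mulf_neq0 //; split=> //.
rewrite -mulNr addf_div ?tofrac_eq0 // rmorphB !rmorphM /= mulNr.
by rewrite rmorphB !rmorphM.
Qed.

(** By minimality of the generated subfield, it suffices that the fractions of the image form a
    subfield containing the generators. *)
Lemma image_field_fraction x : image_field F x -> image_fraction F x.
Proof.
apply; split=> [|y]; first split.
- by rewrite in_setE -tofrac1 -(rmorph1 F); apply: image_fraction_tofrac.
- by move=> x' y; rewrite !in_setE; apply: image_fractionB.
- by move=> x' y; rewrite !in_setE; apply: image_fraction_div.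
case=> [[c _ <-]|[i _ <-]]; last exact: image_fraction_tofrac.
by rewrite -(lrmorph_mpolyC F); apply: image_fraction_tofrac.
Qed.

(** An empty basis cannot produce [1]. With a single basis element, [x] and [1] are both multiples
    of it, and the quotient of their coefficients is [x]. *)
Lemma degree_le1_fraction m x :
  extension_degree (image_field F) m -> (m <= 1)%N -> image_fraction F x.
Proof.
case=> b bP; case: m b bP => [|[|//]] b bP _.
  have [c [[_ /eqP]]] := bP 1.
  by rewrite big_ord0 oner_eq0.
have [c [[cK]]] := bP x; rewrite big_ord1 => xE _.
have [d [[dK]]] := bP 1; rewrite big_ord1 => dE _.
have d0 : d ord0 != 0.
  by apply/eqP => d0; move/eqP: dE; rewrite d0 mul0r oner_eq0.
have -> : x = c ord0 / d ord0.
  by rewrite xE -[b ord0](mulKf d0) -dE mulr1.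
by apply: image_fraction_div; apply: image_field_fraction.
Qed.

Hypothesis jacF : invertible_jacobian F.

(** The image of [F] is a subalgebra, so surjectivity need only be checked on the variables, where
    [denominator_free] applies. Injectivity turns a chosen right inverse into a two-sided one. *)
Lemma birational_jacobian_bijective :
  (forall x, image_fraction F x) -> bijective F.
Proof.
move=> allF; have Finj := jacobian_injective jacF.
suff surjF y : exists x, F x = y.
  have [G GK] := choice surjF; exists G => // x.
  exact/Finj/GK.
elim/mpoly_alg_ind: y => [c|i|_ _ [p <-] [q <-]|_ _ [p <-] [q <-]].
- by exists c%:MP; rewrite lrmorph_mpolyC.
- have [p [q [q0 E]]] := allF (tofrac 'X_i).
  apply: (@denominator_free _ _ _ jacF 'X_i p q).
    by apply: contraNneq q0 => ->; rewrite rmorph0.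
  by apply/eqP; rewrite -tofrac_eq tofracM E divfK ?tofrac_eq0.
- by exists (p + q); rewrite rmorphD.
- by exists (p * q); rewrite rmorphM.
Qed.

(** A constant component would give a zero row in the Jacobian matrix. *)
Lemma jacobian_tdeg_gt0 i : (0 < tdeg (F 'X_i))%N.
Proof.
case: jacF => c c0 jE; rewrite lt0n; apply: contraNneq c0 => d0.
have FiE : F 'X_i = ((F 'X_i)@_0)%:MP.
  by apply: msize1_polyC; move: d0; rewrite /tdeg; lia.
rewrite -(mpolyC_eq0 n) -jE /jacobian (expand_det_row _ i) big1 // => j _.
by rewrite mxE FiE mderivC mul0r.
Qed.

End Birational.

(** Bijectivity expresses being an automorphism, since the inverse of a bijective algebra morphism
    is again an algebra morphism. *)
Theorem proposition3p8 (R : realType) (n : nat)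
    (F : {lrmorphism {mpoly R[i][n]} -> {mpoly R[i][n]}}) :
  (0 < n)%N ->
  degree_conjecture R n ->
  invertible_jacobian F ->
  (exists j : 'I_n, tdeg (F 'X_j) = 1%N) ->
  bijective F.
Proof.
move=> _ degR jacF dF.
(* No component has degree [0], so the component of degree [1] attains the minimum and the bound is
   [1 ^ n.-1]. *)
have [|m extF m1] := degR F jacF 1%N.
  by split=> // i; apply: (jacobian_tdeg_gt0 (C := R[i])).
rewrite exp1n in m1.
apply: (birational_jacobian_bijective (C := R[i])) => // x.
exact: (degree_le1_fraction (C := R[i]) _ extF m1).
Qed.
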